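(* There is a constant $C>0$ such that, with $T=\lceil C\frac{\Delta}{\delta}\log n\rceil$, for every graph $G=(V,E)$ with $n$ nodes, minimum degree $\delta$ and maximum degree $\Delta$, and for every set $S\subseteq V$ of initially informed nodes, $T$ rounds of random \textsc{RPull} stochastically dominate a single round of \textsc{Pull} with high probability; that is, there exists a coupling of the random set $S_T^{\textsc{RPull}}$ and the random set $S_1^{\textsc{Pull}}$ (both started from $S_0=S$) under which $\Pr\big(S_1^{\textsc{Pull}}\not\subseteq S_T^{\textsc{RPull}}\big)\le n^{-c}$ for some constant $c>1$.
   Context: Rumor spreading proceeds in synchronous rounds; for an algorithm ALG, $S_t^{\mathrm{ALG}}$ is the set of informed nodes after $t$ rounds starting from $S_0^{\mathrm{ALG}}=S$. \textsc{Pull}: in each round, every uninformed node contacts a neighbor chosen uniformly at random and learns the rumor if that neighbor was informed at the start of the round (an informed node may serve arbitrarily many requests). Random \textsc{RPull}: in each round, every uninformed node sends a request to a uniformly random neighbor; every informed node $v$ that receives a nonempty set $R_v$ of requests selects one node of $R_v$ uniformly at random (independently across nodes and rounds), and only that node learns the rumor. A coupling of two random sets $X_1,X_2$ is a joint distribution of a pair $(\hat X_1,\hat X_2)$ whose marginals equal the distributions of $X_1$ and $X_2$. *)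

(* Defs.v *)
From mathcomp Require Import all_boot all_order all_algebra.
From mathcomp Require Import reals exp.
Set Implicit Arguments. Unset Strict Implicit. Unset Printing Implicit Defensive.
Import Order.TTheory GRing.Theory Num.Theory.
Local Open Scope ring_scope.

Section Rumor.
Variables (R : realType) (V : finType) (e : rel V).

(* simple graph given by a symmetric irreflexive relation e *)
Definition nbrs (v : V) : {set V} := [set u | e v u].
Definition deg (v : V) : nat := #|nbrs v|.
(* minimum and maximum degree (for nonempty V; deg v < #|V|) *)
Definition mindeg : nat := \big[minn/#|V|]_(v : V) deg v.
Definition maxdeg : nat := \max_(v : V) deg v.

(* Probability weight of a request profile f: every node u independently
   picks a uniformly random neighbour f u (choices of informed nodes are
   dummies that are never used; they sum out to 1). *)
Definition req_w (f : {ffun V -> V}) : R :=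
  \prod_(u : V) (if e u (f u) then (deg u)%:R^-1 else 0).

Definition pull_out (A : {set V}) (f : {ffun V -> V}) : {set V} :=
  A :|: [set u | f u \in A].
Definition pull_dist (A B : {set V}) : R :=
  \sum_(f : {ffun V -> V}) req_w f * (pull_out A f == B)%:R.

Definition reqs (A : {set V}) (f : {ffun V -> V}) (v : V) : {set V} :=
  [set u | (u \notin A) && (f u == v)].
(* weight of a selection profile g: every informed v with R_v nonempty picks
   g v in R_v uniformly, independently; otherwise g v = v (dummy). *)
Definition sel_w (A : {set V}) (f g : {ffun V -> V}) : R :=
  \prod_(v : V)
    (if (v \in A) && (reqs A f v != set0) then
       (if g v \in reqs A f v then (#|reqs A f v|)%:R^-1 else 0)
     else (g v == v)%:R).
Definition rpull_out (A : {set V}) (f g : {ffun V -> V}) : {set V} :=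
  A :|: [set g v | v in [set w in A | reqs A f w != set0]].
Definition rpull_step (A B : {set V}) : R :=
  \sum_(f : {ffun V -> V}) \sum_(g : {ffun V -> V})
     req_w f * sel_w A f g * (rpull_out A f g == B)%:R.
Fixpoint rpull_dist (t : nat) (S B : {set V}) : R :=
  match t with
  | 0 => (B == S)%:R
  | t'.+1 => \sum_(A : {set V}) rpull_dist t' S A * rpull_step A B
  end.

Definition coupling (mu1 mu2 : {set V} -> R) (P : {set V} * {set V} -> R) : Prop :=
  [/\ forall p, 0 <= P p,
      forall X, \sum_(Y : {set V}) P (X, Y) = mu1 X
    & forall Y, \sum_(X : {set V}) P (X, Y) = mu2 Y].

End Rumor.

(* Main.v *)
Require Import Defs.
From mathcomp Require Import all_boot all_order all_algebra.
From mathcomp Require Import fingroup perm.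
From mathcomp Require Import reals sequences exp.
From mathcomp Require Import ring lra.
Import Order.TTheory GRing.Theory Num.Theory.
Local Open Scope ring_scope.
Set Implicit Arguments. Unset Strict Implicit. Unset Printing Implicit Defensive.

(** The selections of an RPULL round can be realised by a uniformly random order
    of the nodes, every informed node serving its first requester. Reveal the
    requests along this order. When an uninformed node [u] sends its request, a
    fraction [x] of its neighbours in [S] has not been requested before; [u] wins
    if it hits one of those, and then its PULL bit is decided to be 1. If it
    requests a node outside [S], its bit is decided to be 0 with probability [x];
    otherwise the bit remains undecided. A decided bit is thus 1 with probability
    exactly [|N(u) ∩ S| / deg u] given the whole past, so the bits obtained over
    the rounds, completed independently for the undecided nodes, have the law of
    one PULL round, and the coupling can only fail at an undecided node. A node
    is decided with probability [E x >= 1 / (1 + Δ/δ)] per round, because a fixed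
    neighbour receives at most [Δ/δ] other requests on average. *)

(** * RPULL selections realised by a uniformly random order of the nodes *)

Section RandomOrder.
Variables (R : realType) (V : finType).
Implicit Types (s : {perm V}) (f g : {ffun V -> V}) (A B Q : {set V}).

(** A permutation encodes a linear order: [s] sends each node to a position in the fixed enumeration
    of [V]. *)
Definition before s u w := (enum_rank (s u) < enum_rank (s w))%N.

Lemma before_irr s u : before s u u = false.
Proof. exact: ltnn. Qed.

Lemma before_total s u w : ~~ before s u w -> ~~ before s w u -> u = w.
Proof.
rewrite /before -!leqNgt => le1 le2; apply: (@perm_inj _ s); apply: enum_rank_inj.
by apply/val_inj/eqP; rewrite /= eqn_leq le1 le2.
Qed.

Definition is_first s Q u := (u \in Q) && [forall w in Q, ~~ before s w u].

Lemma is_firstP s Q u :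
  reflect (u \in Q /\ forall w, w \in Q -> ~~ before s w u) (is_first s Q u).
Proof.
by apply: (iffP andP) => -[uQ /forall_inP hu].
Qed.

Lemma is_first_uniq s Q u w : is_first s Q u -> is_first s Q w -> u = w.
Proof. by move=> /is_firstP[uQ hu] /is_firstP[wQ hw]; apply: before_total; auto. Qed.

Lemma is_first_ex s Q u : u \in Q -> exists w, is_first s Q w.
Proof.
move=> uQ; exists [arg min_(w < u in Q) enum_rank (s w)]%N.
by case: arg_minnP => // w wQ hw; apply/is_firstP; split=> // x /hw; rewrite /before -leqNgt.
Qed.

Definition first s Q d := odflt d [pick u | is_first s Q u].

Lemma firstE s Q d u : is_first s Q u -> first s Q d = u.
Proof.
rewrite /first => hu; case: pickP => [w hw|/(_ u)]; last by rewrite hu.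
exact: is_first_uniq hw hu.
Qed.

Lemma first_is s Q d : Q != set0 -> is_first s Q (first s Q d).
Proof. by case/set0Pn=> u /(is_first_ex s)[w hw]; rewrite (firstE d hw). Qed.

(** Precomposing the order with a permutation that stabilises [Q] moves the first element along. The
    injection [s |-> p * s] then compares the numbers of orders with different winners. *)
Lemma is_first_perm s (p : {perm V}) Q u :
  (forall w, w \in Q -> p w \in Q) -> is_first s Q (p u) -> u \in Q -> is_first (p * s)%g Q u.
Proof.
move=> pQ /is_firstP[_ hs] uQ; apply/is_firstP; split=> // w wQ.
by rewrite /before !permM; apply/hs/pQ.
Qed.

Lemma card_perm_gt0 : (0 < #|{perm V}|)%N.
Proof. by apply/card_gt0P; exists 1%g. Qed.

Definition avg_perm (F : {perm V} -> R) : R := (#|{perm V}|%:R)^-1 * \sum_s F s.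

(** Transposing two elements of [Q] shows that each is first in equally many orders; these numbers
    add up to the number of all orders. *)
Lemma avg_perm_is_first Q u : u \in Q ->
  avg_perm (fun s => (is_first s Q u)%:R) = (#|Q|%:R)^-1.
Proof.
move=> uQ; pose N w := #|[set s | is_first s Q w]|.
have le_N w x : w \in Q -> x \in Q -> (N w <= N x)%N.
  move=> wQ xQ; rewrite /N -(card_imset _ (mulgI (tperm w x))).
  apply/subset_leq_card/subsetP => _ /imsetP[s hs ->]; rewrite !inE in hs *.
  apply: is_first_perm; rewrite ?tpermR // => y yQ.
  by case: tpermP => // ->.
have NE w : w \in Q -> N w = N u by move=> wQ; apply/eqP; rewrite eqn_leq !le_N.
have Q0 : Q != set0 by apply/set0Pn; exists u.
have sumN : (\sum_(w in Q) N w = #|{perm V}|)%N.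
  have firstQ s : first s Q u \in Q by have /is_firstP[] := first_is s u Q0.
  rewrite -sum1_card (partition_big (fun s => first s Q u) (mem Q)) //=.
  apply: eq_bigr => w wQ; rewrite /N -sum1_card; apply: eq_bigl => s; rewrite inE.
  by apply/idP/eqP => [/firstE-> //|<-]; apply: first_is.
rewrite (eq_bigr (fun=> N u)) // sum_nat_const in sumN.
have cQ0 : #|Q|%:R != 0 :> R by rewrite pnatr_eq0 cards_eq0.
have N0 : (N u)%:R != 0 :> R.
  rewrite pnatr_eq0 -lt0n; have := card_perm_gt0.
  by rewrite -sumN muln_gt0 => /andP[].
rewrite /avg_perm -natr_sum -sumN natrM (_ : (\sum_s _)%N = N u).
  by field; rewrite cQ0 N0.
rewrite /N -sum1_card big_mkcond /= [RHS]big_mkcond; apply: eq_bigr => s _.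
by rewrite inE; case: ifP.
Qed.

Definition active A f v := (v \in A) && (reqs A f v != set0).

Definition winner A f s : {ffun V -> V} :=
  [ffun v => if active A f v then first s (reqs A f v) v else v].

(** The support of [sel_w R A f]. *)
Definition valid A f g :=
  [forall v, if active A f v then g v \in reqs A f v else g v == v].

Lemma winner_valid A f s : valid A f (winner A f s).
Proof.
apply/forallP => v; rewrite ffunE; case av: (active A f v) => //; case/andP: av => _ h.
by have /is_firstP[] := first_is s v h.
Qed.

Lemma winnerP A f s g : valid A f g ->
  reflect (forall v, active A f v -> is_first s (reqs A f v) (g v)) (winner A f s == g).
Proof.
move=> /forallP hg; apply: (iffP eqP) => [<- v hv|h].
  by rewrite ffunE hv; case/andP: hv => _ /first_is.
apply/ffunP => v; have := hg v; rewrite ffunE.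
by case: ifP => [/h/firstE->|_ /eqP->].
Qed.

Lemma reqs_inE A f v u : (u \in reqs A f v) = (u \notin A) && (f u == v).
Proof. by rewrite inE. Qed.

(* Exchanging [g v] with [g' v] for all active [v] at once is an involution of
   the nodes that preserves every request set. *)
Lemma card_winner_le A f g g' : valid A f g -> valid A f g' ->
  (#|[set s | winner A f s == g]| <= #|[set s | winner A f s == g']|)%N.
Proof.
move=> hg hg'.
pose phi u := if active A f (f u) && (u \notin A) then tperm (g (f u)) (g' (f u)) u else u.
have phi_reqs v u : u \in reqs A f v -> phi u \in reqs A f v.
  move=> uR; rewrite /phi; case: ifP => // /andP[av _].
  have -> : f u = v by move: uR; rewrite reqs_inE => /andP[_ /eqP].
  have fv : f u = v by move: uR; rewrite reqs_inE => /andP[_ /eqP].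
  rewrite fv in av.
  by case: tpermP => // _; [have := forallP hg' v|have := forallP hg v]; rewrite av.
have phiA u : u \in A -> phi u = u by rewrite /phi => ->; rewrite andbF.
have phiK : involutive phi.
  move=> u; case uA: (u \in A); first by rewrite !phiA.
  have := phi_reqs (f u) u; rewrite !reqs_inE uA eqxx => /(_ isT)/andP[puA /eqP fpu].
  rewrite {1}/phi fpu puA andbT /phi uA /= andbT.
  by case: (active A f (f u)); rewrite ?tpermK.
pose p := perm (inv_inj phiK).
rewrite -(card_imset _ (mulgI p)).
apply/subset_leq_card/subsetP => _ /imsetP[s hs ->].
rewrite !inE in hs *; move/(winnerP s hg): hs => hs.
apply/(winnerP _ hg') => v av.
have g'R : g' v \in reqs A f v by have := forallP hg' v; rewrite av.
apply: is_first_perm => // [w wR|]; first by rewrite permE; apply: phi_reqs.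
move: (g'R); rewrite reqs_inE => /andP[g'A /eqP fg'].
by rewrite permE /phi fg' av g'A tpermR; apply: hs.
Qed.

Lemma sum_sel_w A f : \sum_g sel_w R A f g = 1.
Proof.
pose F v y : R := if active A f v then (if y \in reqs A f v then (#|reqs A f v|)%:R^-1 else 0)
                  else (y == v)%:R.
rewrite -(bigA_distr_bigA F) big1 // => v _; rewrite /F; case av: (active A f v).
  case/andP: av => _ h.
  rewrite -big_mkcond /= sumr_const -[LHS]mulr_natr mulVf //.
  by rewrite pnatr_eq0 cards_eq0.
by rewrite (bigD1 v) //= eqxx big1 ?addr0 // => i /negbTE->.
Qed.

(** Both sides are constant on valid profiles, vanish on the others and have total mass 1. *)
Lemma sel_w_winner A f g :
  sel_w R A f g = avg_perm (fun s => (winner A f s == g)%:R).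
Proof.
have n0 : #|{perm V}|%:R != 0 :> R by rewrite pnatr_eq0 -lt0n card_perm_gt0.
have avgE h : avg_perm (fun s => (winner A f s == h)%:R)
    = #|{perm V}|%:R^-1 * #|[set s | winner A f s == h]|%:R.
  rewrite /avg_perm -natr_sum -sum1_card big_mkcond /=; congr (_ * _%:R).
  by rewrite [RHS]big_mkcond; apply: eq_bigr => s _; rewrite inE; case: ifP.
pose c : R := \prod_v (if active A f v then (#|reqs A f v|)%:R^-1 else 1).
have selE h : sel_w R A f h = if valid A f h then c else 0.
  rewrite /sel_w; case: ifP => [/forallP hv|/negbT].
    by apply: eq_bigr => v _; have := hv v; rewrite /active; case: ifP => _ ->.
  rewrite negb_forall => /existsP[v hv]; rewrite (bigD1 v) //=; move: hv.
  by rewrite /active; case: ifP => _ /negbTE->; rewrite mul0r.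
have avgV h : ~~ valid A f h -> avg_perm (fun s => (winner A f s == h)%:R) = 0.
  move=> hh; rewrite /avg_perm big1 ?mulr0 // => s _; case: eqP => // E.
  by move: hh; rewrite -E winner_valid.
have [hg|hg] := boolP (valid A f g); last by rewrite avgV // selE (negbTE hg).
have E : \sum_h avg_perm (fun s => (winner A f s == h)%:R) = 1.
  rewrite /avg_perm -mulr_sumr exchange_big /= (eq_bigr (fun=> 1)).
    by rewrite sumr_const mulVf.
  move=> s _; rewrite (bigD1 (winner A f s)) //= eqxx big1 ?addr0 // => h.
  by rewrite eq_sym => /negbTE->.
have := sum_sel_w A f; rewrite -{1}E.
rewrite (bigID (valid A f)) /= [X in _ + X]big1 ?addr0; last first.
  by move=> h /negbTE hh; rewrite selE hh.
rewrite [in RHS](bigID (valid A f)) /= [X in _ = _ + X]big1 ?addr0; last by move=> h /avgV.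
rewrite (eq_bigr (fun=> sel_w R A f g)); last by move=> h hh; rewrite !selE hh hg.
rewrite [in RHS](eq_bigr (fun=> avg_perm (fun s => (winner A f s == g)%:R))); last first.
  move=> h hh; rewrite !avgE; congr (_ * _%:R); apply/eqP.
  by rewrite eqn_leq !card_winner_le.
rewrite !sumr_const => /eqP; rewrite eqrMn2r => /orP[|/eqP//].
by rewrite eqn0Ngt => /negP[]; apply/card_gt0P; exists g.
Qed.

Definition taken A s f u : {set V} := [set f w | w in [set w | (w \notin A) && before s w u]].

(** The same round read sequentially: [u] is served exactly when it is the first to reach its
    informed target. *)
Definition seq_out A s f : {set V} := A :|: [set u | (u \notin A) && (f u \in A :\: taken A s f u)].

Lemma rpull_out_winner A s f : rpull_out A f (winner A f s) = seq_out A s f.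
Proof.
rewrite /rpull_out /seq_out; congr (_ :|: _); apply/setP => u; rewrite inE.
apply/imsetP/andP => [[v]|[uA]].
  rewrite inE => av ->; have := first_is s v (andP av).2.
  rewrite ffunE /active av => /is_firstP[]; rewrite reqs_inE => /andP[uA /eqP fu] hw.
  rewrite uA inE fu (andP av).1 andbT; split=> //.
  apply/imsetP => -[w]; rewrite inE => /andP[wA bw] E.
  by have := hw w; rewrite reqs_inE wA -E eqxx bw => /(_ isT).
rewrite inE => /andP[nt fuA].
have uR : u \in reqs A f (f u) by rewrite reqs_inE uA eqxx.
have av : active A f (f u) by rewrite /active fuA; apply/set0Pn; exists u.
exists (f u); rewrite ?inE // ffunE av; apply/esym/firstE/is_firstP; split=> // w.
rewrite reqs_inE => /andP[wA /eqP fw]; apply: contra nt => bw.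
by apply/imsetP; exists w => //; rewrite inE wA.
Qed.

Lemma sum_sel_out A f B :
  \sum_g sel_w R A f g * (rpull_out A f g == B)%:R =
  avg_perm (fun s => (seq_out A s f == B)%:R).
Proof.
under eq_bigr => g _ do rewrite sel_w_winner /avg_perm -mulrA mulr_suml.
rewrite -mulr_sumr exchange_big /=; congr (_ * _); apply: eq_bigr => s _.
rewrite (bigD1 (winner A f s)) //= eqxx mul1r rpull_out_winner big1 ?addr0 //.
by move=> g; rewrite eq_sym => /negbTE->; rewrite mul0r.
Qed.

End RandomOrder.

(** * Averages over independent uniform requests *)

Section RandomRequests.
Variables (R : realType) (V : finType) (e : rel V).
Hypothesis deg_gt0 : forall u, (0 < deg e u)%N.
Implicit Types (s : {perm V}) (f g : {ffun V -> V}) (A B Q : {set V}).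

Definition reqp u y : R := if e u y then (deg e u)%:R^-1 else 0.

Definition avg_req (F : {ffun V -> V} -> R) : R := \sum_f req_w R e f * F f.

Definition upd f u y : {ffun V -> V} := [ffun w => if w == u then y else f w].

Lemma upd_eq f u y : upd f u y u = y.
Proof. by rewrite ffunE eqxx. Qed.

Lemma upd_neq f u y w : w != u -> upd f u y w = f w.
Proof. by move=> /negbTE wu; rewrite ffunE wu. Qed.

Lemma upd_upd f u y z : upd (upd f u z) u y = upd f u y.
Proof. by apply/ffunP => w; rewrite !ffunE; case: (w == u). Qed.

Lemma reqp_ge0 u y : 0 <= reqp u y.
Proof. by rewrite /reqp; case: ifP; rewrite // invr_ge0 ler0n. Qed.

Lemma req_w_ge0 f : 0 <= req_w R e f.
Proof. by apply: prodr_ge0 => u _; exact: reqp_ge0. Qed.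

Lemma sum_reqp_set u A : \sum_(y in A) reqp u y = #|nbrs e u :&: A|%:R / (deg e u)%:R.
Proof.
rewrite /reqp -big_mkcondr /= sumr_const mulr_natl; congr (_ *+ _).
by apply: eq_card => y; rewrite !inE andbC.
Qed.

Lemma sum_reqp u : \sum_y reqp u y = 1.
Proof.
have d0 : (deg e u)%:R != 0 :> R by rewrite pnatr_eq0 -lt0n.
rewrite -(divff d0); have := sum_reqp_set u setT; rewrite setIT => <-.
by apply: eq_bigl => y; rewrite inE.
Qed.

(** Exchanging [y] with the value of [f] at [u] is an involution on the pairs [(f, y)]; after it the
    summand no longer involves [y], which gives the factor [#|V|]. *)
Lemma sum_upd (F : {ffun V -> V} -> R) u :
  \sum_f \sum_y F (upd f u y) = #|V|%:R * \sum_f F f.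
Proof.
pose h (p : {ffun V -> V} * V) := (upd p.1 u p.2, p.1 u).
have hK : involutive h.
  move=> [f y]; rewrite /h /= upd_eq; congr pair; apply/ffunP => w.
  by rewrite !ffunE; case: eqP => // ->.
rewrite pair_big /=; transitivity (\sum_(p : {ffun V -> V} * V) F p.1).
  by rewrite [RHS](reindex_inj (inv_inj hK)).
rewrite -(pair_big xpredT xpredT (fun f (_ : V) => F f)) /= mulr_sumr.
by apply: eq_bigr => f _; rewrite sumr_const mulr_natl.
Qed.

(** Resampling the request of [u] leaves the product law unchanged. It serves as conditioning on all
    the other requests. *)
Lemma avg_req_tower u F :
  avg_req F = avg_req (fun f => \sum_y reqp u y * F (upd f u y)).
Proof.
have V0 : #|V|%:R != 0 :> R by rewrite pnatr_eq0 -lt0n; apply/card_gt0P; exists u.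
apply: (mulfI V0); rewrite /avg_req -!(sum_upd _ u); apply: eq_bigr => f _.
pose w0 := \prod_(w | w != u) reqp w (f w).
have wE y : req_w R e (upd f u y) = reqp u y * w0.
  rewrite /req_w (bigD1 u) //= upd_eq; congr (_ * _).
  by apply: eq_bigr => w wu; rewrite upd_neq.
transitivity (w0 * \sum_y reqp u y * F (upd f u y)).
  by rewrite mulr_sumr; apply: eq_bigr => y _; rewrite wE mulrCA mulrA.
rewrite -[LHS]mul1r -(sum_reqp u) mulr_suml; apply: eq_bigr => y _.
by rewrite wE -mulrA; under [in RHS]eq_bigr do rewrite upd_upd.
Qed.

Lemma avg_req1 : avg_req (fun=> 1) = 1.
Proof.
rewrite /avg_req; under eq_bigr do rewrite mulr1.
by rewrite -(bigA_distr_bigA reqp) big1 // => u _; exact: sum_reqp.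
Qed.

Lemma eq_avg_req F G : F =1 G -> avg_req F = avg_req G.
Proof. by move=> FG; apply: eq_bigr => f _; rewrite FG. Qed.

Lemma le_avg_req F G : (forall f, F f <= G f) -> avg_req F <= avg_req G.
Proof. by move=> FG; apply: ler_sum => f _; rewrite ler_wpM2l ?req_w_ge0. Qed.

Lemma avg_reqZ c F : avg_req (fun f => c * F f) = c * avg_req F.
Proof. by rewrite /avg_req mulr_sumr; apply: eq_bigr => f _; rewrite mulrCA. Qed.

Lemma avg_reqD F G : avg_req (fun f => F f + G f) = avg_req F + avg_req G.
Proof. by rewrite /avg_req -big_split; apply: eq_bigr => f _; rewrite /= mulrDr. Qed.

Lemma avg_req_sum (I : finType) (P : pred I) (F : I -> {ffun V -> V} -> R) :
  avg_req (fun f => \sum_(i | P i) F i f) = \sum_(i | P i) avg_req (F i).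
Proof. by rewrite /avg_req exchange_big; apply: eq_bigr => f _; rewrite mulr_sumr. Qed.

Lemma avg_req_cst c : avg_req (fun=> c) = c.
Proof. by rewrite -[RHS]mulr1 -avg_req1 -avg_reqZ; apply: eq_avg_req => f; rewrite mulr1. Qed.

Lemma avg_req_marginal u (F : V -> R) : avg_req (fun f => F (f u)) = \sum_y reqp u y * F y.
Proof.
rewrite (avg_req_tower u) -[RHS]avg_req_cst; apply: eq_avg_req => f.
by apply: eq_bigr => y _; rewrite upd_eq.
Qed.

(* Factors that are revealed along the order [s]: the requests are summed out
   starting from the last node. *)
Lemma avg_req_prod s (G : V -> {ffun V -> V} -> R) (c : V -> R) :
    (forall u w f y, w != u -> ~~ before s w u -> G u (upd f w y) = G u f) ->
    (forall u f, \sum_y reqp u y * G u (upd f u y) = c u) ->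
  avg_req (fun f => \prod_u G u f) = \prod_u c u.
Proof.
move=> Gloc Gsum; pose r u := enum_rank (s u).
(* Induction on the number [m] of initial positions of the order whose factors are kept. *)
suff H m : avg_req (fun f => \prod_(u | (r u < m)%N) G u f) = \prod_(u | (r u < m)%N) c u.
  have rV u : (r u < #|V|)%N = true by rewrite ltn_ord.
  have := H #|V|; rewrite (eq_bigl _ _ rV) => <-.
  by apply: eq_avg_req => f; rewrite (eq_bigl _ _ rV).
elim: m => [|m IH].
  rewrite [RHS]big_pred0 // -[RHS]avg_req1; apply: eq_avg_req => f; rewrite big_pred0 //.
have [mV|Vm] := ltnP m #|V|; last first.
  have rV k u : (#|V| <= k)%N -> (r u < k)%N = true by apply: leq_trans; apply: ltn_ord.
  have E u : (r u < m.+1)%N = (r u < m)%N by rewrite !rV // leqW.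
  by rewrite (eq_bigl _ _ E) -IH; apply: eq_avg_req => f; rewrite (eq_bigl _ _ E).
pose u0 := (s^-1)%g (enum_val (Ordinal mV)).
have ru0 : r u0 = m :> nat by rewrite /r /u0 permKV enum_valK.
have ltE u : (r u < m.+1)%N && (u != u0) = (r u < m)%N.
  rewrite ltnS; case: (eqVneq u u0) => [->|uu0]; first by rewrite ru0 ltnn andbF.
  rewrite andbT leq_eqVlt; case: eqP => //= rE; case/eqP: uu0.
  by apply: (@perm_inj _ s); apply: enum_rank_inj; apply: val_inj; rewrite /= -/(r u) rE -ru0.
(* The node [u0] at position [m] is the last one kept, so no other kept factor sees its request, and
   averaging over that request turns its own factor into [c u0]. *)
rewrite (bigD1 u0) /= ?ru0 // (eq_bigl _ _ ltE) -IH -avg_reqZ (avg_req_tower u0).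
apply: eq_avg_req => f; rewrite -(Gsum u0 f) mulr_suml; apply: eq_bigr => y _.
rewrite (bigD1 u0) /= ?ru0 // (eq_bigl _ _ ltE) mulrA; congr (_ * _).
apply: eq_bigr => u ru; apply: Gloc.
  by apply: contraTneq ru => <-; rewrite ru0 ltnn.
by rewrite /before -/(r u) -/(r u0) ru0 -leqNgt ltnW.
Qed.

End RandomRequests.

(** * One RPULL round together with the gradual decision of the PULL bits *)

Section Resolution.
Variables (R : realType) (V : finType) (e : rel V).
Hypothesis deg_gt0 : forall u, (0 < deg e u)%N.
Implicit Types (s : {perm V}) (f g : {ffun V -> V}) (A B C S tk : {set V}).
Implicit Types (z : option bool) (Z : {ffun V -> option bool}).

Definition avg2 (F : {perm V} -> {ffun V -> V} -> R) : R :=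
  avg_perm (fun s => avg_req e (F s)).

Lemma eq_avg_perm (F G : {perm V} -> R) : F =1 G -> avg_perm F = avg_perm G.
Proof. by move=> FG; rewrite /avg_perm (eq_bigr G). Qed.

Lemma avg_perm_cst (c : R) : avg_perm (fun _ : {perm V} => c) = c.
Proof.
rewrite /avg_perm sumr_const -[c *+ _]mulr_natl mulrA mulVf ?mul1r //.
by rewrite pnatr_eq0 -lt0n card_perm_gt0.
Qed.

Lemma le_avg_perm (F G : {perm V} -> R) : (forall s, F s <= G s) -> avg_perm F <= avg_perm G.
Proof. by move=> FG; rewrite ler_wpM2l ?invr_ge0 ?ler0n // ler_sum. Qed.

Lemma eq_avg2 F G : (forall s f, F s f = G s f) -> avg2 F = avg2 G.
Proof. by move=> FG; apply: eq_avg_perm => s; apply: eq_avg_req. Qed.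

Lemma le_avg2 F G : (forall s f, F s f <= G s f) -> avg2 F <= avg2 G.
Proof. by move=> FG; apply: le_avg_perm => s; apply: le_avg_req. Qed.

Lemma avg2_cst (c : R) : avg2 (fun _ _ => c) = c.
Proof. by rewrite /avg2 (eq_avg_perm (fun=> avg_req_cst deg_gt0 c)) avg_perm_cst. Qed.

Lemma avg2_ge0 F : (forall s f, 0 <= F s f) -> 0 <= avg2 F.
Proof. by move=> F0; rewrite -(avg2_cst 0) le_avg2. Qed.

Lemma avg2_sum (I : finType) (P : pred I) (F : I -> {perm V} -> {ffun V -> V} -> R) :
  avg2 (fun s f => \sum_(i | P i) F i s f) = \sum_(i | P i) avg2 (F i).
Proof.
rewrite /avg2 (eq_avg_perm (fun s => avg_req_sum e P (fun i => F i s))).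
by rewrite /avg_perm exchange_big mulr_sumr.
Qed.

Lemma avg2_exchange F : avg2 F = avg_req e (fun f => avg_perm (fun s => F s f)).
Proof.
rewrite /avg2 /avg_perm /avg_req exchange_big mulr_sumr; apply: eq_bigr => f _.
by rewrite [RHS]mulrCA [in RHS]mulr_sumr.
Qed.

Lemma avg2Z (c : R) F : avg2 (fun s f => c * F s f) = c * avg2 F.
Proof.
rewrite /avg2 (eq_avg_perm (fun s => avg_reqZ e c (F s))) /avg_perm -mulr_sumr.
by rewrite mulrCA.
Qed.

Lemma avg2_compl F : avg2 (fun s f => 1 - F s f) = 1 - avg2 F.
Proof.
apply/eqP; rewrite eq_sym subr_eq -[X in X == _](avg2_cst 1) /avg2 /avg_perm -mulrDr -big_split.
by apply/eqP; congr (_ * _); apply: eq_bigr => s _; rewrite /= -avg_reqD;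
  apply: eq_avg_req => f; rewrite subrK.
Qed.

Lemma rpull_step_avg2 A B : rpull_step R e A B = avg2 (fun s f => (seq_out A s f == B)%:R).
Proof.
rewrite avg2_exchange; apply: eq_bigr => f _; rewrite -sum_sel_out mulr_sumr.
by apply: eq_bigr => g _; rewrite mulrA.
Qed.

Variable S : {set V}.

Definition srcs u : {set V} := nbrs e u :&: S.
Definition pprob u : R := #|srcs u|%:R / (deg e u)%:R.
(* For a node without informed neighbour this is [0 / 0 = 0]. *)
Definition blocked tk u : R := #|srcs u :&: tk|%:R / #|srcs u|%:R.

(* Law of the new status of [u], given its old status [z], its request [y] and
   the set [tk] of nodes requested earlier in the order: [Some b] means that the
   PULL bit of [u] is decided to be [b], [None] that it is still undecided.
   A request outside [S] is discarded with the same probability as one to [S]. *)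
Definition resolve A u tk y z z' : R :=
  if (u \in A) || (z != None) then (z' == z)%:R
  else if y \in S then (z' == (if y \in tk then None else Some true))%:R
  else (z' == None)%:R * blocked tk u + (z' == Some false)%:R * (1 - blocked tk u).

(** The conditional probability that the PULL bit of [u] ends up as [b], given its status [z]; an
    undecided bit is completed by a coin of bias [pprob u]. *)
Definition bitp (b : bool) u z : R :=
  if z is Some c then (c == b)%:R else if b then pprob u else 1 - pprob u.

Lemma pprob_ge0 u : 0 <= pprob u.
Proof. by rewrite divr_ge0 ?ler0n. Qed.

Lemma pprob_le1 u : pprob u <= 1.
Proof. by rewrite ler_pdivrMr ?ltr0n // mul1r ler_nat subset_leq_card // subsetIl. Qed.

Lemma blocked_ge0 tk u : 0 <= blocked tk u.
Proof. by rewrite divr_ge0 ?ler0n. Qed.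

Lemma blocked_le1 tk u : blocked tk u <= 1.
Proof.
rewrite /blocked; have [->|h] := posnP #|srcs u|; first by rewrite invr0 mulr0.
by rewrite ler_pdivrMr ?ltr0n // mul1r ler_nat subset_leq_card // subsetIl.
Qed.

Lemma resolve_ge0 A u tk y z z' : 0 <= resolve A u tk y z z'.
Proof.
rewrite /resolve; case: ifP => _; first exact: ler0n.
case: ifP => _; first exact: ler0n.
by rewrite addr_ge0 // mulr_ge0 ?ler0n ?blocked_ge0 // subr_ge0 blocked_le1.
Qed.

Lemma bitp_ge0 b u z : 0 <= bitp b u z.
Proof.
by case: z => [c|]; rewrite /bitp ?ler0n //; case: b; rewrite ?pprob_ge0 // subr_ge0 pprob_le1.
Qed.

Lemma sum_eqz z (F : option bool -> R) : \sum_z' (z' == z)%:R * F z' = F z.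
Proof. by rewrite (bigD1 z) //= eqxx mul1r big1 ?addr0 // => z' /negbTE->; rewrite mul0r. Qed.

Lemma sum_resolve A u tk y z (F : option bool -> R) :
  \sum_z' resolve A u tk y z z' * F z' =
  if (u \in A) || (z != None) then F z
  else if y \in S then (if y \in tk then F None else F (Some true))
  else blocked tk u * F None + (1 - blocked tk u) * F (Some false).
Proof.
rewrite /resolve; case: (_ || _); first exact: sum_eqz.
case: (y \in S); first by rewrite sum_eqz; case: (y \in tk).
under eq_bigr do rewrite mulrDl -!mulrA.
by rewrite big_split /= !sum_eqz mulrA.
Qed.

Lemma sum_resolve1 A u tk y z : \sum_z' resolve A u tk y z z' = 1.
Proof.
have := sum_resolve A u tk y z (fun=> 1); under eq_bigr do rewrite mulr1.
move=> ->; case: (_ || _) => //; case: (y \in S); first by case: ifP.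
by rewrite !mulr1 addrC subrK.
Qed.

(** Requests inside and outside [S] fail to decide the bit with the same probability [blocked tk u].
    Hence being decided is independent of the value, which is 1 with probability [pprob u]. *)
Lemma avg_resolve A u tk z (F : option bool -> R) : u \notin A -> z = None ->
  \sum_y reqp R e u y * \sum_z' resolve A u tk y z z' * F z' =
  blocked tk u * F None +
  (1 - blocked tk u) * (pprob u * F (Some true) + (1 - pprob u) * F (Some false)).
Proof.
move=> uA ->; under eq_bigr do rewrite sum_resolve (negbTE uA) /=.
have sumS : \sum_(y in S) reqp R e u y = pprob u by rewrite sum_reqp_set.
have sumSt : \sum_(y in S | y \in tk) reqp R e u y = pprob u * blocked tk u.
  transitivity (\sum_(y in S :&: tk) reqp R e u y); first by apply: eq_bigl => y; rewrite inE.
  rewrite sum_reqp_set setIA /pprob /blocked -/(srcs u) mulrAC; congr (_ / _).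
  (* The factor [#|srcs u|] cancels only when it is nonzero; otherwise both numerators vanish. *)
  have [h|h] := posnP #|srcs u|; last by rewrite mulrC divfK // pnatr_eq0 -lt0n.
  rewrite h mul0r; apply/eqP; rewrite pnatr_eq0 -leqn0 -h.
  by rewrite subset_leq_card // subsetIl.
have sumSnt : \sum_(y in S | y \notin tk) reqp R e u y = pprob u * (1 - blocked tk u).
  have := sumS; rewrite (bigID (mem tk)) /= sumSt => h.
  by apply: (addrI (pprob u * blocked tk u)); rewrite h; ring.
have sumNS : \sum_(y | y \notin S) reqp R e u y = 1 - pprob u.
  have := sum_reqp R deg_gt0 u; rewrite (bigID (mem S)) /= sumS => h.
  by apply: (addrI (pprob u)); rewrite h; ring.
rewrite (bigID (mem S)) /= [in LHS](bigID (mem tk)) /=.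
rewrite (eq_bigr (fun y => reqp R e u y * F None)); last by move=> y /andP[-> ->].
rewrite [X in _ + X + _](eq_bigr (fun y => reqp R e u y * F (Some true))); last first.
  by move=> y /andP[-> /negbTE->].
rewrite [X in _ + _ + X](eq_bigr (fun y => reqp R e u y *
   (blocked tk u * F None + (1 - blocked tk u) * F (Some false)))); last first.
  by move=> y /negbTE->.
by rewrite -!mulr_suml sumSt sumSnt sumNS; ring.
Qed.

(* The PULL bits are a martingale under [resolve]. *)
Lemma avg_resolve_bitp A u tk z b :
  \sum_y reqp R e u y * \sum_z' resolve A u tk y z z' * bitp b u z' = bitp b u z.
Proof.
have [h|] := boolP ((u \in A) || (z != None)).
  under eq_bigr do rewrite sum_resolve h.
  by rewrite -mulr_suml (sum_reqp R deg_gt0) mul1r.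
rewrite negb_or negbK => /andP[uA /eqP zN]; rewrite (avg_resolve _ _ uA zN) zN /bitp.
by case: b => /=; ring.
Qed.

Lemma taken_upd A s f u w y : ~~ before s w u -> taken A s (upd f w y) u = taken A s f u.
Proof.
move=> h; apply: eq_in_imset => x; rewrite inE => /andP[_ b]; rewrite upd_neq //.
by apply: contraTneq b => ->.
Qed.

(** The conditional probability that PULL produces [C], given the statuses [Z]. *)
Definition pull_mart C Z : R := \prod_u bitp (u \in C) u (Z u).

(** Transition weights of the Markov chain of informed set and statuses. Both components use the
    same order and requests, which is what couples them. *)
Definition kernel A Z A' Z' : R :=
  avg2 (fun s f => (seq_out A s f == A')%:R *
                   \prod_u resolve A u (taken A s f u) (f u) (Z u) (Z' u)).

Lemma pull_mart_ge0 C Z : 0 <= pull_mart C Z.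
Proof. by apply: prodr_ge0 => u _; apply: bitp_ge0. Qed.

Lemma sum_pull_mart Z : \sum_C pull_mart C Z = 1.
Proof.
transitivity (\prod_u (bitp true u (Z u) + bitp false u (Z u))).
  rewrite bigA_distr; apply: eq_bigr => C _; apply: eq_bigr => u _.
  by case: (u \in C).
rewrite big1 // => u _; case: (Z u) => [[]|] /=; rewrite ?addr0 ?add0r //.
by rewrite addrC subrK.
Qed.

Lemma kernel_ge0 A Z A' Z' : 0 <= kernel A Z A' Z'.
Proof.
apply: avg2_ge0 => s f; rewrite mulr_ge0 ?ler0n //.
by apply: prodr_ge0 => u _; exact: resolve_ge0.
Qed.

Lemma sum_kernel A Z A' : \sum_Z' kernel A Z A' Z' = rpull_step R e A A'.
Proof.
rewrite -avg2_sum rpull_step_avg2; apply: eq_avg2 => s f.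
rewrite -mulr_sumr -(bigA_distr_bigA (fun u => resolve A u (taken A s f u) (f u) (Z u))).
by rewrite big1 ?mulr1 // => u _; exact: sum_resolve1.
Qed.

(** Given the order and the requests, the new informed set is determined and the new statuses are
    independent, so the sum over [Z'] factorises. *)
Lemma sum_kernel_weighted A Z (G : V -> option bool -> R) :
  \sum_A' \sum_Z' kernel A Z A' Z' * \prod_u G u (Z' u) =
  avg2 (fun s f => \prod_u \sum_z resolve A u (taken A s f u) (f u) (Z u) z * G u z).
Proof.
under eq_bigr => A' _ do under eq_bigr => Z' _ do rewrite mulrC -avg2Z.
under eq_bigr => A' _ do rewrite -avg2_sum.
rewrite -avg2_sum; apply: eq_avg2 => s f; rewrite bigA_distr_bigA exchange_big /=.
apply: eq_bigr => Z' _; rewrite (bigD1 (seq_out A s f)) //= eqxx mul1r.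
rewrite [X in _ + X]big1 ?addr0 => [|A']; first by rewrite mulrC -big_split.
by rewrite eq_sym => /negbTE->; rewrite mul0r mulr0.
Qed.

(** For a fixed order, the factor of [u] depends only on the requests of [u] and of earlier nodes,
    and its mean over the request of [u] is [bitp] at the old status. Revealing along the order
    multiplies these means. *)
Lemma kernel_pull_mart A Z C :
  \sum_A' \sum_Z' kernel A Z A' Z' * pull_mart C Z' = pull_mart C Z.
Proof.
rewrite (sum_kernel_weighted A Z (fun u => bitp (u \in C) u)) -[RHS]avg_perm_cst.
apply: eq_avg_perm => s.
apply: (@avg_req_prod _ _ _ deg_gt0 s) => [u w f y wu h|u f].
  by rewrite taken_upd // upd_neq // eq_sym.
under eq_bigr => y _ do rewrite taken_upd ?before_irr // upd_eq.
exact: avg_resolve_bitp.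
Qed.

(** The invariant behind the coupling: a bit decided to be 1 belongs to an informed node. The
    converse may fail, since a node can be informed by a neighbour outside [S]. *)
Definition consistent A Z := (S \subset A) && [forall u, (Z u == Some true) ==> (u \in A)].

(** A bit becomes 1 only through a request to an untaken node of [S]; as [S] lies in [A], that
    request is served in the same round. *)
Lemma kernel_consistent A Z A' Z' :
  consistent A Z -> ~~ consistent A' Z' -> kernel A Z A' Z' = 0.
Proof.
move=> /andP[SA /forallP hZ] nc.
rewrite -[RHS](avg2_cst 0); apply: eq_avg2 => s f.
case: eqP => [E|]; last by rewrite mul0r.
have AA' : A \subset A' by rewrite -E subsetUl.
move: nc; rewrite /consistent (subset_trans SA AA') /= negb_forall => /existsP[u].
rewrite negb_imply => /andP[/eqP Z'u uA'].
have uA : u \notin A by apply: contra uA'; apply: (subsetP AA').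
rewrite (bigD1 u) //= /resolve Z'u (negbTE uA) /=.
case Zu: (Z u) => [c|] /=.
  case: c Zu => [Zu|_]; last by rewrite mul0r mulr0.
  by have := hZ u; rewrite Zu eqxx (negbTE uA).
case: ifP => fS; last by rewrite !mul0r addr0 mul0r mulr0.
case: ifP => ft; first by rewrite mul0r mulr0.
by move: uA'; rewrite -E !inE uA ft (subsetP SA _ fS) orbT.
Qed.

End Resolution.

(** * Decay of the undecided nodes, and the coupling over several rounds *)

Section Coupling.
Variables (R : realType) (V : finType) (e : rel V) (S : {set V}).
Hypothesis e_sym : symmetric e.
Variables dmin dmax : nat.
Hypothesis dmin_gt0 : (0 < dmin)%N.
Hypothesis dmin_le : forall u, (dmin <= deg e u)%N.
Hypothesis dmax_ge : forall u, (deg e u <= dmax)%N.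
Implicit Types (s : {perm V}) (f g : {ffun V -> V}) (A B C tk : {set V}).
Implicit Types (z : option bool) (Z : {ffun V -> option bool}).

Let deg_gt0 u : (0 < deg e u)%N := leq_trans dmin_gt0 (dmin_le u).
Let a : R := 1 + dmax%:R / dmin%:R.

Let a_ge1 : 1 <= a.
Proof. by rewrite lerDl divr_ge0 ?ler0n. Qed.

(** At most [dmax] neighbours can request [v], each with probability at most [1 / dmin]. *)
Lemma sum_reqp_to v : \sum_w reqp R e w v <= dmax%:R / dmin%:R.
Proof.
apply: (@le_trans _ _ (\sum_(w | e v w) dmin%:R^-1)).
  rewrite big_mkcond /= [leRHS]big_mkcond; apply: ler_sum => w _.
  rewrite /reqp e_sym; case: ifP => // _.
  by rewrite lef_pV2 ?posrE ?ltr0n // ler_nat.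
rewrite sumr_const -[leLHS]mulr_natl ler_wpM2r ?invr_ge0 ?ler0n // ler_nat.
apply: leq_trans (dmax_ge v); rewrite /deg; apply/eq_leq/eq_card => w.
by rewrite !inE.
Qed.

(** [u] is added to the requesters of [v] because its own request may go elsewhere. *)
Lemma taken_is_first A s f u v : u \notin A ->
  (v \notin taken A s f u) = is_first s (u |: reqs A f v) u.
Proof.
move=> uA; apply/idP/is_firstP => [/negP h|[_ h]].
  split=> [|w]; first by rewrite setU11.
  rewrite in_setU1 reqs_inE => /predU1P[->|/andP[wA /eqP fw]]; first by rewrite before_irr.
  by apply/negP => bw; apply/h/imsetP; exists w => //; rewrite inE wA.
apply/imsetP => -[w]; rewrite inE => /andP[wA bw] vE; have := h w.
by rewrite in_setU1 reqs_inE wA vE eqxx orbT bw => /(_ isT).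
Qed.

(** The tangent at [a] lies below the convex function [1 / x]; this replaces an appeal to Jensen's
    inequality. *)
Lemma inv_tangent (x : R) : 0 < x -> 2 / a - x / a ^+ 2 <= x^-1.
Proof.
move=> x0; have a0 : 0 < a by apply: lt_le_trans a_ge1.
rewrite -subr_ge0.
have -> : x^-1 - (2 / a - x / a ^+ 2) = (x - a) ^+ 2 / (x * a ^+ 2) by field; lra.
by rewrite divr_ge0 ?sqr_ge0 // mulr_ge0 ?sqr_ge0 // ltW.
Qed.

(** For fixed requests, [u] precedes all requesters of [v] with probability one over the size of
    that set with [u] added. The mean size is at most [a], and convexity passes this bound to the
    inverse. *)
Lemma avg_not_taken A u v : u \notin A ->
  a^-1 <= avg2 e (fun s f => (v \notin taken A s f u)%:R) :> R.
Proof.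
move=> uA; rewrite avg2_exchange.
rewrite (eq_avg_req e (G := fun f => (#|u |: reqs A f v|%:R)^-1 : R)); last first.
  move=> f; rewrite -(avg_perm_is_first R (setU11 u (reqs A f v))).
  by apply: eq_avg_perm => s; rewrite taken_is_first.
have a0 : 0 < a by apply: lt_le_trans a_ge1.
(* The tangent line evaluated at 1 plus the number of all nodes pointing to [v], a bound for the
   size that is affine in independent indicators. *)
pose G f : R := (2 / a - 1 / a ^+ 2) + (- (a ^+ 2)^-1) * \sum_w (f w == v)%:R.
apply: (@le_trans _ _ (avg_req e G)).
  rewrite avg_reqD avg_reqZ avg_req_cst // (avg_req_sum e xpredT (fun w f => (f w == v)%:R)).
  rewrite (eq_bigr (fun w => reqp R e w v)); last first.
    move=> w _; rewrite (avg_req_marginal deg_gt0 w (fun y => (y == v)%:R)).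
    by rewrite (bigD1 v) //= eqxx mulr1 big1 ?addr0 // => y /negbTE->; rewrite mulr0.
  have := sum_reqp_to v; have -> : dmax%:R / dmin%:R = a - 1 by rewrite /a addrAC subrr add0r.
  set q := \sum_w _ => hq; rewrite -subr_ge0.
  have -> : 2 / a - 1 / a ^+ 2 + - (a ^+ 2)^-1 * q - a^-1 = (a - 1 - q) / a ^+ 2 by field; lra.
  by rewrite divr_ge0 ?sqr_ge0 // subr_ge0.
apply: le_avg_req => f; apply: le_trans (inv_tangent _); last first.
  by rewrite ltr0n; apply/card_gt0P; exists u; rewrite setU11.
rewrite /G.
have : (#|u |: reqs A f v|%:R <= 1 + \sum_w (f w == v)%:R :> R).
  rewrite -natr_sum addrC natr1 ler_nat (leq_trans (leq_card_setU _ _)) // cards1 add1n ltnS.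
  rewrite -sum1_card big_mkcond /=; apply: leq_sum => w _; rewrite reqs_inE.
  by case: (_ \notin _); case: (_ == _).
set q := \sum_w _; set c := #|_|%:R => hc.
rewrite -subr_ge0.
have -> : 2 / a - c / a ^+ 2 - (2 / a - 1 / a ^+ 2 + - (a ^+ 2)^-1 * q) = (1 + q - c) / a ^+ 2.
  by field; lra.
by rewrite divr_ge0 ?sqr_ge0 // subr_ge0.
Qed.

Lemma avg_blocked A u : u \notin A ->
  avg2 e (fun s f => blocked R e S (taken A s f u) u) <= 1 - a^-1.
Proof.
move=> uA; have a1 : a^-1 <= 1 by rewrite invf_le1 ?a_ge1 // (lt_le_trans _ a_ge1).
have [h|h] := posnP #|srcs e S u|.
  rewrite (eq_avg2 e (G := fun _ _ => 0)) ?avg2_cst ?subr_ge0 // => s f.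
  by rewrite /blocked h invr0 mulr0.
have E s f : blocked R e S (taken A s f u) u =
    #|srcs e S u|%:R^-1 * \sum_(v in srcs e S u) (1 - (v \notin taken A s f u)%:R).
  rewrite /blocked mulrC; congr (_ * _).
  rewrite -sum1_card natr_sum big_mkcond /= [in RHS]big_mkcond.
  apply: eq_bigr => v _; rewrite in_setI; case: (v \in srcs _ _ _) => //=.
  by case: (v \in taken _ _ _ _); rewrite /= ?subr0 ?subrr.
rewrite (eq_avg2 e E) avg2Z (avg2_sum e _ (fun v s f => 1 - (v \notin taken A s f u)%:R)).
rewrite ler_pdivrMl ?ltr0n // mulr_natl -sumr_const; apply: ler_sum => v _.
by rewrite avg2_compl // lerB // avg_not_taken.
Qed.

(** The nodes where the coupling can still fail: an informed node is harmless whatever its bit. *)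
Definition unresolved u A Z := (u \notin A) && (Z u == None).

Lemma kernel_unresolved u A Z :
  \sum_A' \sum_(Z' | unresolved u A' Z') kernel R e S A Z A' Z' <=
  (1 - a^-1) * (unresolved u A Z)%:R.
Proof.
have [/andP[uA /eqP Zu]|nu] := boolP (unresolved u A Z); last first.
  (* A resolved node stays resolved: informed nodes remain informed and decided bits never
     change. *)
  rewrite mulr0 big1 // => A' _; rewrite big1 // => Z' /andP[uA' /eqP Z'u].
  rewrite -[RHS](avg2_cst deg_gt0 0); apply: eq_avg2 => s f.
  case: eqP => [E|]; last by rewrite mul0r.
  have uA : u \notin A by move: uA'; rewrite -E inE negb_or => /andP[].
  move: nu; rewrite /unresolved uA /= => Zu.
  rewrite (bigD1 u) //= /resolve Zu orbT Z'u eq_sym (negbTE Zu).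
  by rewrite mul0r mulr0.
rewrite mulr1; apply: le_trans (avg_blocked uA).
(* The requirement that [u] is still uninformed is dropped; only the status of [u] is tested, and
   the other factors sum to 1. *)
pose G w z : R := if w == u then (z == None)%:R else 1.
have GE Z' : \prod_w G w (Z' w) = (Z' u == None)%:R.
  by rewrite (bigD1 u) //= /G eqxx big1 ?mulr1 // => w /negbTE->.
apply: (@le_trans _ _ (\sum_A' \sum_Z' kernel R e S A Z A' Z' * \prod_w G w (Z' w))).
  apply: ler_sum => A' _; rewrite big_mkcond /=; apply: ler_sum => Z' _.
  rewrite GE /unresolved; case: (_ \notin _); case: (_ == _); rewrite ?mulr1 ?mulr0 //=.
  exact: kernel_ge0.
rewrite sum_kernel_weighted // (eq_avg2 e (G := fun s f =>
    \sum_z resolve R e S A u (taken A s f u) (f u) (Z u) z * (z == None)%:R)); last first.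
  move=> s f; rewrite (bigD1 u) //= /G eqxx [X in _ * X]big1 ?mulr1 // => w /negbTE->.
  by under eq_bigr do rewrite mulr1; exact: sum_resolve1.
(* [taken] at [u] ignores the request of [u], so averaging over that request leaves exactly the
   blocked fraction. *)
apply: le_avg_perm => s; rewrite (avg_req_tower deg_gt0 u); apply: le_avg_req => f.
under eq_bigr => y _ do rewrite taken_upd ?before_irr // upd_eq.
rewrite (avg_resolve deg_gt0 _ _ (fun z => (z == None)%:R) uA Zu) /=.
by rewrite !mulr0 addr0 !mulr0 addr0 mulr1.
Qed.

Definition init : {ffun V -> option bool} := [ffun u => if u \in S then Some true else None].

Fixpoint joint t A Z : R :=
  if t is t'.+1 then \sum_A0 \sum_Z0 joint t' A0 Z0 * kernel R e S A0 Z0 A Z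
  else ((A == S) && (Z == init))%:R.

Lemma joint_ge0 t A Z : 0 <= joint t A Z.
Proof.
elim: t A Z => [|t IH] A Z /=; first exact: ler0n.
by do 2!apply: sumr_ge0 => ? _; rewrite mulr_ge0 // kernel_ge0.
Qed.

Lemma sum_joint0 (F : {set V} -> {ffun V -> option bool} -> R) :
  \sum_A \sum_Z joint 0 A Z * F A Z = F S init.
Proof.
rewrite (bigD1 S) //= [X in _ + X]big1 ?addr0 => [|A /negbTE AS]; last first.
  by rewrite big1 // => Z _; rewrite AS mul0r.
rewrite (bigD1 init) //= !eqxx mul1r big1 ?addr0 // => Z /negbTE->.
by rewrite andbF mul0r.
Qed.

Lemma sum_jointS t (F : {set V} -> {ffun V -> option bool} -> R) :
  \sum_A \sum_Z joint t.+1 A Z * F A Z =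
  \sum_A \sum_Z joint t A Z * \sum_A' \sum_Z' kernel R e S A Z A' Z' * F A' Z'.
Proof.
have -> : \sum_A \sum_Z joint t.+1 A Z * F A Z =
  \sum_A \sum_A0 \sum_Z0 \sum_Z joint t A0 Z0 * kernel R e S A0 Z0 A Z * F A Z.
  apply: eq_bigr => A _.
  under eq_bigr => Z _ do (rewrite mulr_suml; under eq_bigr => A0 _ do rewrite mulr_suml).
  by rewrite exchange_big; apply: eq_bigr => A0 _; exact: exchange_big.
rewrite exchange_big; apply: eq_bigr => A0 _; rewrite exchange_big; apply: eq_bigr => Z0 _.
rewrite mulr_sumr; apply: eq_bigr => A _; rewrite mulr_sumr.
by apply: eq_bigr => Z _; rewrite mulrA.
Qed.

Lemma joint_rpull t A : \sum_Z joint t A Z = rpull_dist R e t S A.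
Proof.
elim: t A => [|t IH] A /=.
  rewrite (bigD1 init) //= eqxx andbT big1 ?addr0 // => Z /negbTE->.
  by rewrite andbF.
rewrite exchange_big; apply: eq_bigr => A0 _; rewrite -IH exchange_big /= mulr_suml.
by apply: eq_bigr => Z0 _; rewrite -mulr_sumr sum_kernel.
Qed.

(** PULL informs the nodes independently: those of [S] surely, any other [u] with probability
    [pprob u]. *)
Lemma pull_dist_init C : pull_dist R e S C = pull_mart R e S C init.
Proof.
rewrite /pull_dist /pull_mart.
transitivity (\prod_u \sum_y reqp R e u y * (((u \in S) || (y \in S)) == (u \in C))%:R).
  rewrite bigA_distr_bigA; apply: eq_bigr => f _; rewrite big_split /=; congr (_ * _).
  case: eqP => [<-|neq]; first by rewrite big1 // => u _; rewrite !inE eqxx.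
  have [/forallP h|] := boolP [forall u, ((u \in S) || (f u \in S)) == (u \in C)].
    by case: neq; apply/setP => u; rewrite !inE; apply/eqP.
  by rewrite negb_forall => /existsP[u /negbTE hu]; rewrite (bigD1 u) //= hu mul0r.
apply: eq_bigr => u _; rewrite ffunE; case: (u \in S) => /=.
  by rewrite -mulr_suml sum_reqp // mul1r.
have sumS : \sum_(y in S) reqp R e u y = pprob R e S u by rewrite sum_reqp_set.
have := sum_reqp R deg_gt0 u; rewrite (bigID (mem S)) /= sumS => h.
rewrite (bigID (mem S)) /=; case: (u \in C).
  rewrite [X in _ + X]big1 ?addr0 => [|y /negbTE->]; last by rewrite mulr0.
  by rewrite -sumS; apply: eq_bigr => y ->; rewrite mulr1.
rewrite big1 ?add0r => [|y ->]; last by rewrite mulr0.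
apply: (addrI (pprob R e S u)); rewrite [RHS]addrC subrK -[RHS]h; congr (_ + _).
by apply: eq_bigr => y /negbTE->; rewrite eqxx mulr1.
Qed.

Lemma joint_pull t C :
  \sum_A \sum_Z joint t A Z * pull_mart R e S C Z = pull_dist R e S C.
Proof.
rewrite pull_dist_init; elim: t => [|t IH].
  exact: (sum_joint0 (fun=> pull_mart R e S C)).
rewrite (sum_jointS t (fun=> pull_mart R e S C)) -IH.
by apply: eq_bigr => A _; apply: eq_bigr => Z _; rewrite kernel_pull_mart.
Qed.

Lemma joint_consistent t A Z : ~~ consistent S A Z -> joint t A Z = 0.
Proof.
elim: t A Z => [|t IH] A Z nc /=.
  case: andP => // -[/eqP AS /eqP ZE]; move: nc; rewrite AS ZE /consistent subxx /=.
  by case/negP; apply/forallP => u; rewrite ffunE; case: (u \in S).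
rewrite big1 // => A0 _; rewrite big1 // => Z0 _.
have [c|/IH->] := boolP (consistent S A0 Z0); last by rewrite mul0r.
by rewrite (kernel_consistent R deg_gt0 c nc) mulr0.
Qed.

(** Each round multiplies the probability by at most [1 - a^-1], whatever the current state. *)
Lemma joint_unresolved t u :
  \sum_A \sum_Z joint t A Z * (unresolved u A Z)%:R <= (1 - a^-1) ^+ t.
Proof.
have a1 : a^-1 <= 1 by rewrite invf_le1 ?a_ge1 // (lt_le_trans _ a_ge1).
elim: t => [|t IH].
  by rewrite (sum_joint0 (fun A Z => (unresolved u A Z)%:R)) lern1 leq_b1.
rewrite (sum_jointS t (fun A Z => (unresolved u A Z)%:R)) exprS.
apply: le_trans (ler_wpM2l _ IH); last by rewrite subr_ge0.
rewrite mulr_sumr; apply: ler_sum => A _; rewrite mulr_sumr; apply: ler_sum => Z _.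
rewrite mulrCA ler_wpM2l ?joint_ge0 // (le_trans _ (kernel_unresolved u A Z)) //.
apply: ler_sum => A' _; rewrite [leRHS]big_mkcond; apply: ler_sum => Z' _ /=.
by case: ifP => _; rewrite ?mulr1 ?mulr0.
Qed.

(** After [t] rounds the undecided bits are completed independently. The first marginal follows by
    summing out the bits, the second from the martingale property. *)
Definition rpull_pull_coupling t (p : {set V} * {set V}) : R :=
  \sum_Z joint t p.1 Z * pull_mart R e S p.2 Z.

Lemma rpull_pull_couplingP t :
  coupling (rpull_dist R e t S) (pull_dist R e S) (rpull_pull_coupling t).
Proof.
split=> [p|X|Y].
- by apply: sumr_ge0 => Z _; rewrite mulr_ge0 ?joint_ge0 ?pull_mart_ge0.
- rewrite exchange_big -joint_rpull; apply: eq_bigr => Z _ /=.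
  by rewrite -mulr_sumr sum_pull_mart mulr1.
- by rewrite -(joint_pull t).
Qed.

(** Take a node of [C] outside [A]. If it is unresolved, the sum is at least 1; otherwise
    consistency forces its bit to be 0, and the weight of [C] vanishes. *)
Lemma pull_mart_not_subset A Z C : consistent S A Z -> ~~ (C \subset A) ->
  pull_mart R e S C Z <= pull_mart R e S C Z * \sum_u (unresolved u A Z)%:R :> R.
Proof.
move=> /andP[_ /forallP hZ] /subsetPn[u uC uA].
have [un|un] := boolP (unresolved u A Z).
  rewrite ler_peMr ?pull_mart_ge0 // (bigD1 u) //= un lerDl.
  by apply: sumr_ge0 => w _; rewrite ler0n.
have Zu : Z u = Some false.
  move: un (hZ u); rewrite /unresolved uA /=.
  by case: (Z u) => [[]|] //=; rewrite (negbTE uA).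
by rewrite /pull_mart (bigD1 u) //= Zu /bitp uC !mul0r.
Qed.

(** A union bound over the unresolved nodes. *)
Lemma rpull_pull_coupling_fail t :
  \sum_(p : {set V} * {set V} | ~~ (p.2 \subset p.1)) rpull_pull_coupling t p <=
  #|V|%:R * (1 - a^-1) ^+ t.
Proof.
rewrite mulr_natl -sumr_const.
apply: (@le_trans _ _ (\sum_u \sum_A \sum_Z joint t A Z * (unresolved u A Z)%:R)); last first.
  by apply: ler_sum => u _; exact: joint_unresolved.
rewrite [leRHS]exchange_big /=.
have -> : \sum_(p : {set V} * {set V} | ~~ (p.2 \subset p.1)) rpull_pull_coupling t p =
    \sum_(A : {set V}) \sum_(C : {set V} | ~~ (C \subset A)) rpull_pull_coupling t (A, C).
  by rewrite [RHS]pair_big_dep /=; apply: eq_bigr => -[].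
apply: ler_sum => A _; rewrite exchange_big [leRHS]exchange_big /=.
apply: ler_sum => Z _; rewrite -!mulr_sumr.
have [c|/joint_consistent->] := boolP (consistent S A Z); last by rewrite !mul0r.
rewrite ler_wpM2l ?joint_ge0 //.
set m := \sum_u _; apply: (@le_trans _ _ (\sum_C pull_mart R e S C Z * m)); last first.
  by rewrite -mulr_suml sum_pull_mart mul1r.
rewrite big_mkcond /=; apply: ler_sum => C _; case: ifP => [h|_].
  exact: pull_mart_not_subset.
rewrite mulr_ge0 ?pull_mart_ge0 //; apply: sumr_ge0 => w _; exact: ler0n.
Qed.

End Coupling.

(** * Degree bounds and the choice of constants *)

Lemma mindeg_le (V : finType) (e : rel V) u : (mindeg e <= deg e u)%N.
Proof.
rewrite /mindeg; elim: (index_enum V) (mem_index_enum u) => // v s IH.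
rewrite in_cons big_cons => /predU1P[->|/IH]; first exact: geq_minl.
by apply: leq_trans; exact: geq_minr.
Qed.

Lemma maxdeg_ge (V : finType) (e : rel V) u : (deg e u <= maxdeg e)%N.
Proof. exact: (@leq_bigmax _ (deg e) u). Qed.

Theorem theorem3 (R : realType) :
  exists C : R, 0 < C /\
  exists c : R, 1 < c /\
  forall (V : finType) (e : rel V),
    symmetric e -> irreflexive e -> (0 < mindeg e)%N ->
    forall S : {set V},
      let n : nat := #|V| in
      let T : nat :=
        `|Num.ceil (C * (maxdeg e)%:R / (mindeg e)%:R * ln (n%:R : R))|%N in
      exists P : {set V} * {set V} -> R,
        coupling (@rpull_dist R V e T S) (@pull_dist R V e S) P /\
        \sum_(p : {set V} * {set V} | ~~ (p.2 \subset p.1)) P p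
          <= (n%:R : R) `^ (- c).
Proof.
(* With [r] the degree ratio, [r / (1 + r) >= 1/2], so the decay exponent is at least [3 ln n]. The
   union bound costs one [ln n], which leaves [c = 2]. *)
exists 6; split; first by [].
exists 2; split; first by rewrite ltr1n.
move=> V e e_sym _ dmin0 S n T.
exists (rpull_pull_coupling R e S T); split.
  exact: rpull_pull_couplingP dmin0 (mindeg_le e) _.
(* On an empty graph [mindeg e] is its default [#|V| = 0], which [dmin0] excludes. *)
have [u0 _] : exists u : V, true.
  case: (pickP (@predT V)) => [u _|V0]; first by exists u.
  by move: dmin0; rewrite /mindeg big_pred0 // (eq_card0 V0).
have n0 : (0 < n)%N by apply/card_gt0P; exists u0.
have le_d : (mindeg e <= maxdeg e)%N := leq_trans (mindeg_le e u0) (maxdeg_ge e u0).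
apply: le_trans (rpull_pull_coupling_fail _ _ e_sym dmin0 (mindeg_le e) (@maxdeg_ge _ e) _) _.
set r : R := _%:R / _%:R.
have r1 : 1 <= r by rewrite ler_pdivlMr ?ltr0n // mul1r ler_nat.
have q0 : 0 < (1 + r)^-1 by rewrite invr_gt0; lra.
have L0 : 0 <= ln (n%:R : R) by rewrite ln_ge0 // ler1n.
have TE : 6 * r * ln (n%:R : R) <= T%:R.
  rewrite /T natr_absz [6 * r]mulrA; apply: le_trans (ceil_ge _) _.
  by rewrite ler_int ler_norm.
have nE : expR (ln (n%:R : R)) = n%:R by rewrite lnK // posrE ltr0n.
rewrite /powR pnatr_eq0 (gtn_eqF n0) -[X in X * _]nE.
(* The inequality [1 - x <= exp (- x)] raised to the power [T]. *)
have decay : (1 - (1 + r)^-1) ^+ T <= expR (T%:R * - (1 + r)^-1).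
  rewrite expRM_natl lerXn2r ?nnegrE ?expR_ge0 ?subr_ge0 ?invf_le1 ?expR_ge1Dx //; lra.
apply: le_trans (ler_wpM2l (expR_ge0 _) decay) _.
rewrite -expRD ler_expR.
have half : 2^-1 <= (1 + r)^-1 * r by rewrite ler_pdivlMl; lra.
have := ler_wpM2l (ltW q0) TE; have := ler_wpM2r L0 half; lra.
Qed.
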